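(* Let $G$ be a group which is not perfect (i.e. $G\neq [G,G]$). Then $\varprojlim^1 (R/[F,R])$ is non-trivial, where $\varprojlim^1$ is taken over the category ${\sf Fext}_{\sf Gr}(G)$ of free extensions $R\rightarrowtail F\twoheadrightarrow G$ of the group $G$, i.e. it is $\varprojlim^1\mathfrak F$ for the functor $$\mathfrak F:{\sf Fext}_{\sf Gr}(G)\to{\sf Ab},\qquad (R\rightarrowtail F\twoheadrightarrow G)\mapsto R/[F,R].$$
   Context: The category ${\sf Fext}_{\sf Gr}(G)$: objects are short exact sequences of groups $R\rightarrowtail F\twoheadrightarrow G$ with $F$ a free group; morphisms from $(R_1\rightarrowtail F_1\twoheadrightarrow G)$ to $(R_2\rightarrowtail F_2\twoheadrightarrow G)$ are morphisms of short exact sequences (commutative diagrams) inducing the identity on $G$. Here $R$ is regarded as a normal subgroup of $F$ and $[F,R]$ is the subgroup generated by commutators of elements of $F$ with elements of $R$; a morphism of extensions induces a homomorphism $R_1/[F_1,R_1]\to R_2/[F_2,R_2]$. For a small category ${\sf C}$ and a functor $\mathfrak F:{\sf C}\to{\sf Ab}$, $\varprojlim^i\mathfrak F$ ($i\ge0$) are the right derived functors of $\varprojlim:{\sf Ab}^{\sf C}\to{\sf Ab}$. They are computed as $\varprojlim^n\mathfrak F=H^n(\prod^\bullet\mathfrak F)$, where $\prod^n\mathfrak F=\prod_{i_0\leftarrow i_1\leftarrow\cdots\leftarrow i_n}\mathfrak F(i_0)$ (product over all chains of $n$ composable morphisms in ${\sf C}$) and $$\delta^n(a)(i_0\leftarrow\cdots\leftarrow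 i_{n+1})=\mathfrak F(i_0\leftarrow i_1)\,a(i_1\leftarrow\cdots\leftarrow i_{n+1})+\sum_{j=1}^{n+1}(-1)^j a(i_0\leftarrow\cdots\leftarrow\hat{i_j}\leftarrow\cdots\leftarrow i_{n+1}).$$ The category ${\sf Fext}_{\sf Gr}(G)$ is treated as small (e.g. restrict to groups in a fixed universe, with limits formed in a larger universe). *)

(* Defs.v *)
From HB Require Import structures.
From mathcomp Require Import all_boot ssralg ssrint.
From mathcomp Require Import boolp classical_sets.

Set Implicit Arguments.
Unset Strict Implicit.
Unset Printing Implicit Defensive.

Import GRing.Theory.

Local Open Scope group_scope.
Local Open Scope classical_set_scope.

Notation "{ 'ghom' G -> H }" := (UMagmaMorphism.type G%type H%type)
  (at level 0, G at level 98, H at level 99,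
   format "{ 'ghom'  G  ->  H }") : type_scope.

Definition subgroup (G : groupType) (A : set G) : Prop := group_closed (mem A).

Definition commutator_subgroup (G : groupType) (A B : set G) : set G :=
  smallest (@subgroup G) [set z | exists2 a, A a & exists2 b, B b & z = [~ a, b]].

Definition perfect (G : groupType) : Prop :=
  commutator_subgroup [set: G] [set: G] = [set: G].

Definition free_group (F : groupType) : Prop :=
  exists (X : Type) (i : X -> F),
    forall (H : groupType) (h : X -> H),
      (exists phi : {ghom F -> H}, forall x, phi (i x) = h x) /\
      (forall phi psi : {ghom F -> H},
         (forall x, phi (i x) = psi (i x)) -> phi =1 psi).

Record category := Category {
  cat_ob :> Type;
  cat_hom : cat_ob -> cat_ob -> Type;
  cat_id : forall X, cat_hom X X;
  cat_comp : forall X Y Z, cat_hom Y Z -> cat_hom X Y -> cat_hom X Z;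
  cat_comp1m : forall X Y (f : cat_hom X Y), cat_comp (cat_id Y) f = f;
  cat_compm1 : forall X Y (f : cat_hom X Y), cat_comp f (cat_id X) = f;
  cat_compA : forall X Y Z W
      (f : cat_hom Z W) (g : cat_hom Y Z) (h : cat_hom X Y),
    cat_comp f (cat_comp g h) = cat_comp (cat_comp f g) h
}.

Record ab_functor (C : category) := AbFunctor {
  fun_ob :> C -> zmodType;
  fun_mor : forall X Y : C, cat_hom X Y -> {additive fun_ob X -> fun_ob Y};
  fun_mor1 : forall X : C, fun_mor (cat_id X) =1 id;
  fun_morM : forall (X Y Z : C) (f : cat_hom Y Z) (g : cat_hom X Y),
    fun_mor (cat_comp f g) =1 fun_mor f \o fun_mor g
}.

Section HigherLimits.
Local Open Scope ring_scope.
Variable C : category.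

(* [chain n i0] is the type of chains i0 <- i1 <- ... <- in. *)
Fixpoint chain (n : nat) : C -> Type :=
  if n is m.+1 then fun i0 => {i1 : C & (cat_hom i1 i0 * chain m i1)%type}
  else fun=> unit.

(* [face j c] deletes the vertex i_j of the chain c, for 0 < j <= n + 1; the
   deletion of i0, which changes the codomain, is treated apart in
   [coboundary_map]. *)
Fixpoint face (n j : nat) : forall i0 : C, chain n.+1 i0 -> chain n i0 :=
  match n return forall i0 : C, chain n.+1 i0 -> chain n i0 with
  | 0 => fun _ _ => tt
  | m.+1 => fun i0 c =>
      let: existT i1 (f, c1) := c in
      if j is k.+2 then existT _ i1 (f, face k.+1 c1)
      else let: existT i2 (g, c2) := c1 in existT _ i2 (cat_comp f g, c2)
  end.

Arguments face {n} j {i0} c.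

Variable A : ab_functor C.

(* Cochains are not made into a [zmodType]: when the objects of C are built
   from arbitrary groups, they live in a larger universe than that of
   [zmodType]. *)
Definition cochain (n : nat) := forall i0 : C, chain n i0 -> A i0.

Definition coboundary_map (n : nat) (a : cochain n) : cochain n.+1 :=
  fun i0 (c : chain n.+1 i0) =>
    let: existT i1 (f, c1) := c in
    fun_mor A f (a i1 c1) +
    \sum_(1 <= j < n.+2) a i0 (face j c) *~ (-1) ^+ j.

Arguments coboundary_map {n} a i0 c.

Definition zero_cochain (n : nat) : cochain n := fun=> fun=> 0.
Arguments zero_cochain n i0 c : clear implicits.

Definition sub_cochain (n : nat) (a b : cochain n) : cochain n :=
  fun i0 c => a i0 c - b i0 c.

Definition cocycle (n : nat) (a : cochain n) : Prop :=
  coboundary_map a = zero_cochain n.+1.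

Definition coboundary (n : nat) : cochain n -> Prop :=
  match n with
  | 0 => fun a => a = zero_cochain 0
  | m.+1 => fun a => exists b : cochain m, a = coboundary_map b
  end.

Definition cohomology_class (n : nat) (a : cochain n) : cochain n -> Prop :=
  fun b => coboundary (sub_cochain b a).

(* lim^n A, the n-th right derived functor of the limit, given by the n-th
   cohomology of the complex above: the set of cosets of the coboundaries in
   the group of cocycles, with the class of 0 as its neutral element. *)
Definition higher_lim (n : nat) : Type :=
  {S : cochain n -> Prop | exists2 a, cocycle a & S = cohomology_class a}.

Fact cocycle0 (n : nat) : cocycle (zero_cochain n).
Proof.
apply: functional_extensionality_dep => i0.
apply: functional_extensionality_dep => -[i1 [f c1]].
by rewrite /= raddf0 big1 ?addr0// => j _; rewrite mul0rz.
Qed.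

Definition higher_lim0 (n : nat) : higher_lim n :=
  exist _ _ (ex_intro2 _ _ _ (cocycle0 n) erefl).

Definition higher_lim_nontrivial (n : nat) : Prop :=
  exists x : higher_lim n, x <> higher_lim0 n.

End HigherLimits.

Arguments coboundary_map {C A n} a i0 c.
Arguments zero_cochain {C} A n i0 c.
Arguments sub_cochain {C A n} a b i0 c.
Arguments face {C n} j {i0} c.

Record free_ext (G : groupType) := FreeExt {
  ext_R : groupType;
  ext_F : groupType;
  ext_iota : {ghom ext_R -> ext_F};
  ext_pi : {ghom ext_F -> G};
  ext_free : free_group ext_F;
  ext_inj : injective ext_iota;
  ext_exact : forall x, ext_pi x = 1 <-> exists r, ext_iota r = x;
  ext_surj : forall g, exists x, ext_pi x = g
}.

Record free_ext_hom (G : groupType) (E1 E2 : free_ext G) := FreeExtHom {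
  hom_R : {ghom ext_R E1 -> ext_R E2};
  hom_F : {ghom ext_F E1 -> ext_F E2};
  hom_iota : forall r, hom_F (ext_iota E1 r) = ext_iota E2 (hom_R r);
  hom_pi : forall x, ext_pi E2 (hom_F x) = ext_pi E1 x
}.

Section FreeExtCategory.
Variable G : groupType.

Lemma ghom_eq (H K : groupType) (f g : {ghom H -> K}) : f =1 g -> f = g.
Proof.
case: f g => [f [[f1] [fM]]] [g [[g1] [gM]]] /= /funext fg.
by case: _ / fg in g1 gM *; congr UMagmaMorphism.Pack;
  congr UMagmaMorphism.Class; congr (_ _); apply: Prop_irrelevance.
Qed.

Lemma free_ext_hom_eq (E1 E2 : free_ext G) (f g : free_ext_hom E1 E2) :
  hom_R f =1 hom_R g -> hom_F f =1 hom_F g -> f = g.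
Proof.
case: f g => [fR fF f1 f2] [gR gF g1 g2] /= /ghom_eq eR /ghom_eq eF.
case: _ / eR in g1 *; case: _ / eF in g1 g2 *.
by rewrite (Prop_irrelevance f1 g1) (Prop_irrelevance f2 g2).
Qed.

Definition free_ext_id (E : free_ext G) : free_ext_hom E E :=
  @FreeExtHom G E E idfun idfun (fun=> erefl) (fun=> erefl).

Lemma free_ext_comp_iota (E1 E2 E3 : free_ext G)
    (f : free_ext_hom E2 E3) (g : free_ext_hom E1 E2) r :
  (hom_F f \o hom_F g) (ext_iota E1 r) =
  ext_iota E3 ((hom_R f \o hom_R g) r).
Proof. by rewrite /= !hom_iota. Qed.

Lemma free_ext_comp_pi (E1 E2 E3 : free_ext G)
    (f : free_ext_hom E2 E3) (g : free_ext_hom E1 E2) x :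
  ext_pi E3 ((hom_F f \o hom_F g) x) = ext_pi E1 x.
Proof. by rewrite /= !hom_pi. Qed.

Definition free_ext_comp (E1 E2 E3 : free_ext G)
    (f : free_ext_hom E2 E3) (g : free_ext_hom E1 E2) : free_ext_hom E1 E3 :=
  @FreeExtHom G E1 E3 (hom_R f \o hom_R g) (hom_F f \o hom_F g)
    (free_ext_comp_iota f g) (free_ext_comp_pi f g).

Lemma free_ext_comp1m (E1 E2 : free_ext G) (f : free_ext_hom E1 E2) :
  free_ext_comp (free_ext_id E2) f = f.
Proof. exact: free_ext_hom_eq. Qed.

Lemma free_ext_compm1 (E1 E2 : free_ext G) (f : free_ext_hom E1 E2) :
  free_ext_comp f (free_ext_id E1) = f.
Proof. exact: free_ext_hom_eq. Qed.

Lemma free_ext_compA (E1 E2 E3 E4 : free_ext G) (f : free_ext_hom E3 E4)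
    (g : free_ext_hom E2 E3) (h : free_ext_hom E1 E2) :
  free_ext_comp f (free_ext_comp g h) = free_ext_comp (free_ext_comp f g) h.
Proof. exact: free_ext_hom_eq. Qed.

Definition Fext : category :=
  @Category (free_ext G) (@free_ext_hom G) free_ext_id free_ext_comp
    free_ext_comp1m free_ext_compm1 free_ext_compA.

End FreeExtCategory.

Section Generated.
Variables (H : groupType) (A B : set H).

Lemma commutator_subgroup_group : subgroup (commutator_subgroup A B).
Proof.
split=> [|x y].
  by apply/mem_set => S [[/set_mem S1 _] _].
move=> /set_mem xC /set_mem yC; apply/mem_set => S [[S1 SF] sAB].
by apply/set_mem/SF; apply/mem_set; [apply: xC | apply: yC].
Qed.

Lemma commutator_subgroup1 : commutator_subgroup A B 1.
Proof. by case: commutator_subgroup_group => /set_mem. Qed.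

Lemma commutator_subgroupM x y : commutator_subgroup A B x ->
  commutator_subgroup A B y -> commutator_subgroup A B (x * y).
Proof.
move=> xC yC; apply/set_mem; apply: (group_closedM commutator_subgroup_group);
  exact/mem_set.
Qed.

Lemma commutator_subgroupV x :
  commutator_subgroup A B x -> commutator_subgroup A B x^-1.
Proof.
move=> xC; apply/set_mem; apply: (group_closedV commutator_subgroup_group).
exact/mem_set.
Qed.

Lemma mem_commutator_subgroup a b :
  A a -> B b -> commutator_subgroup A B [~ a, b].
Proof. by move=> Aa Bb; apply: sub_gen_smallest; exists a => //; exists b. Qed.

End Generated.

Section Coinvariants.
Variables (G : groupType) (E : free_ext G).

Local Notation R := (ext_R E).
Local Notation F := (ext_F E).
Local Notation iota := (ext_iota E).

Definition commFR : set F := commutator_subgroup [set: F] (range iota).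

Definition coinv_rel (r s : R) : bool := `[< commFR (iota (r / s)) >].

Lemma commFRJ x (r : R) : commFR x -> commFR (x ^ iota r).
Proof.
move=> xC; have -> : x ^ iota r = x * [~ x, iota r] by rewrite mulVKg.
apply: commutator_subgroupM => //; apply: mem_commutator_subgroup => //.
Qed.

Lemma coinv_rel_refl : reflexive coinv_rel.
Proof.
by move=> r; apply/asboolP; rewrite divgg gmulf1; apply: commutator_subgroup1.
Qed.

Lemma coinv_rel_sym : symmetric coinv_rel.
Proof.
suff h r s : coinv_rel r s -> coinv_rel s r by move=> r s; apply/idP/idP; apply: h.
move=> /asboolP C; apply/asboolP; rewrite -invgF gmulfV.
exact: commutator_subgroupV.
Qed.

Lemma coinv_rel_trans : transitive coinv_rel.
Proof.
move=> s r t /asboolP C1 /asboolP C2; apply/asboolP.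
by have := commutator_subgroupM C1 C2; rewrite -gmulfM mulgA divgK.
Qed.

Canonical coinv_equiv :=
  EquivRel coinv_rel coinv_rel_refl coinv_rel_sym coinv_rel_trans.

(* R/[F, R], an abelian group written additively. *)
Definition coinv := {eq_quot coinv_equiv}%qT.
HB.instance Definition _ : EqQuotient R coinv_equiv coinv := EqQuotient.on coinv.
HB.instance Definition _ := Choice.on coinv.

Local Notation pi := (\pi_coinv)%qT.

Lemma coinv_eqP (r s : R) : reflect (commFR (iota (r / s))) (pi r == pi s).
Proof. by rewrite piE; apply: asboolP. Qed.

Lemma coinv_eq (r s : R) : commFR (iota (r / s)) -> pi r = pi s.
Proof. by move=> C; apply/eqP/coinv_eqP. Qed.

Lemma coinv_repr (r : R) : commFR (iota (repr (pi r) / r)).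
Proof. by apply/coinv_eqP; rewrite reprK. Qed.

Lemma coinv_ind (P : coinv -> Prop) : (forall r, P (pi r)) -> forall x, P x.
Proof. by move=> Ppi x; rewrite -[x]reprK. Qed.

Definition coinv_zero : coinv := pi 1.
Definition coinv_opp (x : coinv) : coinv := pi (repr x)^-1.
Definition coinv_add (x y : coinv) : coinv := pi (repr x * repr y).

Lemma coinv_addE (r s : R) : coinv_add (pi r) (pi s) = pi (r * s).
Proof.
apply: coinv_eq; set r' := repr _; set s' := repr _.
have -> : r' * s' / (r * s) = r' / r * ((s' / s) ^ r^-1).
  by rewrite conjgE invgM invgK !mulgA mulgVK.
rewrite gmulfM gmulfJ; apply: commutator_subgroupM; first exact: coinv_repr.
by apply: commFRJ; apply: coinv_repr.
Qed.

Lemma coinv_mulC (r s : R) : pi (r * s) = pi (s * r).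
Proof.
apply: coinv_eq; rewrite (commgCV r s) mulgK gmulfR !gmulfV.
by apply: mem_commutator_subgroup => //; exists s^-1 => //; rewrite gmulfV.
Qed.

Lemma coinv_addA : associative coinv_add.
Proof.
elim/coinv_ind=> r; elim/coinv_ind=> s; elim/coinv_ind=> t.
by rewrite (coinv_addE s t) (coinv_addE r (s * t)) (coinv_addE r s)
  (coinv_addE (r * s) t) mulgA.
Qed.

Lemma coinv_addC : commutative coinv_add.
Proof. by move=> x y; apply: coinv_mulC. Qed.

Lemma coinv_add0 : left_id coinv_zero coinv_add.
Proof. by elim/coinv_ind=> r; rewrite coinv_addE mul1g. Qed.

Lemma coinv_addN : left_inverse coinv_zero coinv_opp coinv_add.
Proof.
by move=> x; rewrite -[x in coinv_add _ x]reprK coinv_addE mulVg.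
Qed.

HB.instance Definition _ :=
  GRing.isZmodule.Build coinv coinv_addA coinv_addC coinv_add0 coinv_addN.

Lemma coinv_piM (r s : R) : pi (r * s) = (pi r + pi s)%R.
Proof. by rewrite -coinv_addE. Qed.

End Coinvariants.

Arguments commFR {G} E _.

Section CoinvariantsMap.
Variables (G : groupType) (E1 E2 : free_ext G) (f : free_ext_hom E1 E2).

Lemma hom_commFR x : commFR E1 x -> commFR E2 (hom_F f x).
Proof.
move=> C; apply: (C [set y | commFR E2 (hom_F f y)]).
split=> [|_ [a _ [_ [r _ <-] ->]]].
  split=> [|y z /set_mem yC /set_mem zC]; apply/mem_set; rewrite /= ?gmulf1.
    exact: commutator_subgroup1.
  rewrite gmulfF; apply: commutator_subgroupM => //.
  exact: commutator_subgroupV.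
rewrite /= gmulfR hom_iota; apply: mem_commutator_subgroup => //.
Qed.

Definition coinv_map (x : coinv E1) : coinv E2 :=
  (\pi_(coinv E2) (hom_R f (repr x)))%qT.

Lemma coinv_mapE (r : ext_R E1) :
  (coinv_map (\pi_(coinv E1) r) = \pi_(coinv E2) (hom_R f r))%qT.
Proof.
apply: coinv_eq; rewrite -gmulfF -hom_iota; apply: hom_commFR.
exact: coinv_repr.
Qed.

Fact coinv_map_is_additive : zmod_morphism coinv_map.
Proof.
have addM : {morph coinv_map : x y / (x + y)%R}.
  elim/coinv_ind=> r; elim/coinv_ind=> s.
  by rewrite -coinv_piM !coinv_mapE gmulfM coinv_piM.
move=> x y; apply: (addIr (coinv_map y)).
by rewrite -addM !subrK.
Qed.

HB.instance Definition _ :=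
  GRing.isZmodMorphism.Build (coinv E1) (coinv E2) coinv_map
    coinv_map_is_additive.

End CoinvariantsMap.

Section CoinvariantsFunctor.
Variable G : groupType.

Lemma coinv_map1 (E : Fext G) : coinv_map (cat_id E) =1 id.
Proof. by move=> x; apply: reprK. Qed.

Lemma coinv_mapM (X Y Z : Fext G) (f : cat_hom Y Z) (g : cat_hom X Y) :
  coinv_map (cat_comp f g) =1 coinv_map f \o coinv_map g.
Proof.
elim/coinv_ind=> r; rewrite /comp.
apply: (etrans (coinv_mapE (free_ext_comp f g) r)); symmetry.
by apply: (etrans (congr1 (coinv_map f) (coinv_mapE g r))); apply: coinv_mapE.
Qed.

(* The functor (R >-> F ->> G) |-> R/[F, R]. *)
Definition coinv_functor : ab_functor (Fext G) :=
  @AbFunctor (Fext G) (fun E => coinv E : zmodType)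
    (fun (X Y : Fext G) (f : cat_hom X Y) => coinv_map f : {additive _ -> _})
    coinv_map1 coinv_mapM.

End CoinvariantsFunctor.

(* Main.v *)
(* Lift an element [g] of [G] to some [x_E] in [F] for every extension
   [E = (R >-> F ->> G)].  The classes of [f x_E1 / x_E2] in [R2/[F2, R2]], for
   [f : E1 -> E2], form a 1-cocycle (it represents the image of [g] under the
   connecting map [G_ab -> lim^1]).  If it is the coboundary of [b], then the
   elements [c_E = b_E^-1 * x_E] of [F/[F, R]] over [g] are preserved by all
   morphisms, up to [[F, R]].  Let [F] be free on [G * bool], both copies of [G]
   being mapped identically to [G].  Let [i1], [i2 : F -> F] collapse the two
   copies of the generators to the first and the second one, and let
   [q : F -> G] evaluate the first copy and kill the second one: then [q \o i1]
   is the projection to [G] and [q \o i2] is trivial, so that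
   [g = q (i1 c_E)] and [1 = q (i2 c_E)] both agree with [q c_E] in [G_ab]. *)
Require Import Defs.
From HB Require Import structures.
From mathcomp Require Import all_boot ssralg ssrint.
From mathcomp Require Import boolp classical_sets.

Set Implicit Arguments.
Unset Strict Implicit.
Unset Printing Implicit Defensive.

Import GRing.Theory.

Local Open Scope group_scope.
Local Open Scope classical_set_scope.

(** The structure is built from compatibility with division, obtained by cancelling [f y] on the
    right. *)
Lemma ghom_of_morph (H K : groupType) (f : H -> K) :
  {morph f : x y / x * y} -> {phi : {ghom H -> K} | phi =1 f}.
Proof.
move=> fM.
have fF : {morph f : x y / x / y}.
  by move=> x y; apply: (mulIg (f y)); rewrite -fM !mulgVK.
pose m := isGroupMorphism.Build H K f fF.
by exists (HB.pack_for {ghom H -> K} f m).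
Qed.

(** * Construction of free groups *)

Section FreeGroup.
Variable X : choiceType.

Definition word := seq (X * bool).

Definition eval_word (H : groupType) (h : X -> H) (w : word) : H :=
  \prod_(l <- w) (if l.2 then (h l.1)^-1 else h l.1).

(* Equality of values in all groups: the universal property of the quotient
   then holds by construction, without normal forms of words. *)
Definition word_rel (v w : word) : bool :=
  `[< forall (H : groupType) (h : X -> H), eval_word h v = eval_word h w >].

Lemma word_rel_refl : reflexive word_rel.
Proof. by move=> w; apply/asboolP. Qed.

Lemma word_rel_sym : symmetric word_rel.
Proof.
by move=> v w; apply/asboolP/asboolP => vw H h; rewrite vw.
Qed.

Lemma word_rel_trans : transitive word_rel.
Proof.
move=> v u w /asboolP uv /asboolP vw; apply/asboolP => H h.
by rewrite uv vw.
Qed.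

Canonical word_equiv :=
  EquivRel word_rel word_rel_refl word_rel_sym word_rel_trans.

Definition free := {eq_quot word_equiv}%qT.
HB.instance Definition _ : EqQuotient word word_equiv free :=
  EqQuotient.on free.
HB.instance Definition _ := Choice.on free.

Local Notation pi := (\pi_free)%qT.

Lemma free_eqP (v w : word) :
  (pi v = pi w) <->
  (forall (H : groupType) (h : X -> H), eval_word h v = eval_word h w).
Proof.
split=> [/eqP|vw]; first by rewrite piE => /asboolP.
by apply/eqP; rewrite piE; apply/asboolP.
Qed.

Definition word_inv (w : word) : word := rev [seq (l.1, ~~ l.2) | l <- w].

Lemma eval_word_cat (H : groupType) (h : X -> H) v w :
  eval_word h (v ++ w) = eval_word h v * eval_word h w.
Proof. exact: big_cat. Qed.

Lemma eval_word_inv (H : groupType) (h : X -> H) w :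
  eval_word h (word_inv w) = (eval_word h w)^-1.
Proof.
elim: w => [|[x b] w IH]; first by rewrite /eval_word !big_nil invg1.
rewrite /word_inv /= rev_cons -cats1 eval_word_cat IH /eval_word big_seq1.
by rewrite big_cons invgM; case: b => /=; rewrite ?invgK.
Qed.

Definition free_one : free := pi [::].
Definition free_inv (x : free) : free := pi (word_inv (repr x)).
Definition free_mul (x y : free) : free := pi (repr x ++ repr y).

Lemma eval_repr (H : groupType) (h : X -> H) w :
  eval_word h (repr (pi w)) = eval_word h w.
Proof. by have /free_eqP -> : pi (repr (pi w)) = pi w by rewrite reprK. Qed.

(** Reduces each group law of [free] to the same law in an arbitrary group [H]. *)
Lemma free_eq (x y : free) :
  (forall (H : groupType) (h : X -> H),
     eval_word h (repr x) = eval_word h (repr y)) -> x = y.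
Proof. by move=> /free_eqP; rewrite !reprK. Qed.

Lemma free_mulA : associative free_mul.
Proof.
move=> x y z; apply: free_eq => H h.
by rewrite !(eval_repr, eval_word_cat) mulgA.
Qed.

Lemma free_mul1 : left_id free_one free_mul.
Proof.
move=> x; apply: free_eq => H h.
by rewrite !(eval_repr, eval_word_cat) /eval_word big_nil mul1g.
Qed.

Lemma free_mulr1 : right_id free_one free_mul.
Proof.
move=> x; apply: free_eq => H h.
by rewrite !(eval_repr, eval_word_cat) /eval_word big_nil mulg1.
Qed.

Lemma free_mulV : left_inverse free_one free_inv free_mul.
Proof.
move=> x; apply: free_eq => H h.
rewrite !(eval_repr, eval_word_cat, eval_word_inv) mulVg.
by rewrite /eval_word big_nil.
Qed.

Lemma free_mulrV : right_inverse free_one free_inv free_mul.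
Proof.
move=> x; apply: free_eq => H h.
rewrite !(eval_repr, eval_word_cat, eval_word_inv) mulgV.
by rewrite /eval_word big_nil.
Qed.

HB.instance Definition _ :=
  isGroup.Build free free_mulA free_mul1 free_mulr1 free_mulV free_mulrV.

Definition free_gen (x : X) : free := pi [:: (x, false)].

Lemma free_lift (H : groupType) (h : X -> H) :
  {phi : {ghom free -> H} | forall x, phi (free_gen x) = h x}.
Proof.
have hM : {morph (fun x : free => eval_word h (repr x)) : x y / x * y}.
  by move=> x y; rewrite eval_repr eval_word_cat.
have [phi phiE] := ghom_of_morph hM.
by exists phi => x; rewrite phiE eval_repr /eval_word big_seq1.
Qed.

Lemma free_hom_ext (H : groupType) (phi psi : {ghom free -> H}) :
  (forall x, phi (free_gen x) = psi (free_gen x)) -> phi =1 psi.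
Proof.
move=> e x; rewrite -[x]reprK; elim: (repr x) => [|[y b] w IH].
  by rewrite -/(1 : free) !gmulf1.
(* The class of a word splits into its first letter and the rest, which drives the induction. *)
have -> : pi ((y, b) :: w) =
          (if b then (free_gen y)^-1 else free_gen y) * pi w.
  apply: free_eq => K k; rewrite !(eval_repr, eval_word_cat).
  rewrite /eval_word big_cons; congr (_ * _); case: b => /=.
    by rewrite -!/(eval_word _ _) !(eval_repr, eval_word_inv) /eval_word big_seq1.
  by rewrite -!/(eval_word _ _) eval_repr /eval_word big_seq1.
by rewrite !gmulfM IH; case: b; rewrite ?gmulfV e.
Qed.

Lemma free_is_free : free_group free.
Proof.
exists X, free_gen => H h; split; last by move=> *; apply: free_hom_ext.
by have [phi phiE] := free_lift h; exists phi.
Qed.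

End FreeGroup.

(** * Free extensions from kernels, and their morphisms *)

Section Kernel.
Variables (H K : groupType) (f : {ghom H -> K}).

Definition ker_pred : pred H := fun x => f x == 1.

Definition kernel := {x : H | ker_pred x}.

Fact ker_closed : group_closed ker_pred.
Proof.
split=> [|x y]; rewrite !unfold_in; first by rewrite gmulf1.
by rewrite gmulfF => /eqP-> /eqP->; rewrite divgg.
Qed.

HB.instance Definition _ := SubChoice.on kernel.
HB.instance Definition _ :=
  SubChoice_isSubGroup.Build H ker_pred kernel ker_closed.

End Kernel.

Section FreeExtensions.
Variable G : groupType.

(** Kept transparent, so that [ext_F] and [ext_pi] of the result reduce to [F] and [p]. *)
Definition kernel_ext (F : groupType) (p : {ghom F -> G}) (Ffree : free_group F)
  (psurj : forall g, exists x, p x = g) : free_ext G.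
Proof.
refine (@FreeExt G (kernel p) F (val : kernel p -> F) p Ffree val_inj _ psurj).
move=> x; split=> [/eqP px|[r <-]]; last exact/eqP/(valP r).
by exists (exist _ x px).
Defined.

(** A map over [G] preserves the kernels; injectivity of [ext_iota E2] makes the chosen preimages
    multiplicative. *)
Lemma free_ext_hom_of (E1 E2 : free_ext G) (phi : {ghom ext_F E1 -> ext_F E2}) :
  (forall x, ext_pi E2 (phi x) = ext_pi E1 x) ->
  {f : free_ext_hom E1 E2 | hom_F f =1 phi}.
Proof.
move=> phiE.
have rP r : exists s, ext_iota E2 s = phi (ext_iota E1 r).
  by apply/ext_exact; rewrite phiE; apply/ext_exact; exists r.
pose fR r := projT1 (cid (rP r)).
have fRE r : ext_iota E2 (fR r) = phi (ext_iota E1 r) := projT2 (cid (rP r)).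
have fRM : {morph fR : r s / r * s}.
  by move=> r s; apply: (@ext_inj _ E2); rewrite gmulfM !fRE !gmulfM.
have [psi psiE] := ghom_of_morph fRM.
have c r : phi (ext_iota E1 r) = ext_iota E2 (psi r) by rewrite psiE fRE.
by exists (FreeExtHom c phiE).
Qed.

End FreeExtensions.

Lemma higher_lim_nontrivialP (C : category) (A : ab_functor C) n
    (a : cochain A n) :
  cocycle a -> ~ coboundary a -> higher_lim_nontrivial A n.
Proof.
move=> aZ aNB.
exists (exist _ (cohomology_class a) (ex_intro2 _ _ a aZ erefl)) => /(congr1 sval).
(* Two equal cosets have the same members; membership of [a] is tested in both. *)
rewrite /= => /(congr1 (@^~ a)); rewrite /cohomology_class.
have -> : sub_cochain a a = zero_cochain A n.
  by do 2![apply: functional_extensionality_dep => ?]; apply: subrr.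
have -> : sub_cochain a (zero_cochain A n) = a.
  by do 2![apply: functional_extensionality_dep => ?]; apply: subr0.
move=> e; apply: aNB; rewrite -e.
case: n {a aZ e} => [//|n] /=.
by exists (zero_cochain A n); rewrite cocycle0.
Qed.

(** * The 1-cocycle of lifts of [g] *)

Section LiftCocycle.
Variables (G : groupType) (g : G).

Definition ext_lift (E : free_ext G) : ext_F E := projT1 (cid (ext_surj E g)).

Lemma ext_liftE (E : free_ext G) : ext_pi E (ext_lift E) = g.
Proof. exact: projT2 (cid (ext_surj E g)). Qed.

Lemma lift_diff_exact (E1 E2 : free_ext G) (f : free_ext_hom E1 E2) :
  exists r, ext_iota E2 r = hom_F f (ext_lift E1) / ext_lift E2.
Proof. by apply/ext_exact; rewrite gmulfF hom_pi !ext_liftE divgg. Qed.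

Definition lift_diff (E1 E2 : free_ext G) (f : free_ext_hom E1 E2) : ext_R E2 :=
  projT1 (cid (lift_diff_exact f)).

Lemma lift_diffE (E1 E2 : free_ext G) (f : free_ext_hom E1 E2) :
  ext_iota E2 (lift_diff f) = hom_F f (ext_lift E1) / ext_lift E2.
Proof. exact: projT2 (cid (lift_diff_exact f)). Qed.

(** The cocycle identity holds already in [ext_R E3], before passing to coinvariants:
    [hom_F f (ext_lift E2)] cancels in the middle. *)
Lemma lift_diff_comp (E1 E2 E3 : free_ext G)
    (f : free_ext_hom E2 E3) (h : free_ext_hom E1 E2) :
  lift_diff (free_ext_comp f h) = hom_R f (lift_diff h) * lift_diff f.
Proof.
apply: (@ext_inj _ E3).
by rewrite gmulfM -hom_iota !lift_diffE gmulfF mulgA mulgVK.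
Qed.

Definition lift_cochain : cochain (coinv_functor G) 1 :=
  fun E2 (c : chain 1 E2) =>
    let: existT E1 (f, _) := c in (\pi_(coinv E2) (lift_diff f))%qT.

Lemma lift_cocycle : cocycle lift_cochain.
Proof.
apply: functional_extensionality_dep => E3.
apply: functional_extensionality_dep => -[E2 [f [E1 [h []]]]].
(* The term [j = 1] is minus the class at the composite, and [j = 2] is the class at [f]. *)
rewrite /coboundary_map big_ltn // big_nat1 /=.
rewrite expr1 mulrN1z sqrrN expr1n mulr1z.
rewrite coinv_mapE lift_diff_comp coinv_piM.
by rewrite opprD subrK subrr.
Qed.

(* An element of the limit of [F/[F, R]] lying over [g]. *)
Lemma compatible_lift : coboundary lift_cochain ->
  exists c : forall E : free_ext G, ext_F E,
    (forall E, ext_pi E (c E) = g) /\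
    (forall E1 E2 (f : free_ext_hom E1 E2), commFR E2 (hom_F f (c E1) / c E2)).
Proof.
move=> [b bE]; pose r E : ext_R E := repr (b E tt).
exists (fun E => (ext_iota E (r E))^-1 * ext_lift E); split=> [E|E1 E2 f].
  rewrite gmulfM gmulfV ext_liftE.
  have -> : ext_pi E (ext_iota E (r E)) = 1 by apply/ext_exact; exists (r E).
  by rewrite invg1 mul1g.
(* Evaluated at [f], [bE] says that the class of [lift_diff f] is the image of [b E1] under [f]
   minus [b E2]. *)
have := congr1 (fun a : cochain (coinv_functor G) 1 =>
  a E2 (existT _ (E1 : Fext G) (f, tt))) bE.
rewrite /coboundary_map /= big_nat1 expr1 mulrN1z.
rewrite -[b E1 tt]reprK -[b E2 tt]reprK coinv_mapE.
move=> /(canLR (subrK _)); rewrite -coinv_piM => bf.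
(* The quotient comes from [ext_R E2]; the division by [1] gives it the shape expected by
   [coinv_eqP]. *)
have -> : hom_F f ((ext_iota E1 (r E1))^-1 * ext_lift E1) /
          ((ext_iota E2 (r E2))^-1 * ext_lift E2) =
          ext_iota E2 ((hom_R f (r E1))^-1 * (lift_diff f * r E2) / 1).
  by rewrite divg1 !gmulfM !gmulfV lift_diffE -hom_iota invgM invgK !mulgA.
by apply/coinv_eqP; rewrite coinv_piM bf -coinv_piM mulVg.
Qed.

End LiftCocycle.

(** * Comparison in the abelianization of [G] *)

Lemma ghom_commutator_subgroup (H K : groupType) (f : {ghom H -> K})
    (A B : set H) x :
  commutator_subgroup A B x -> commutator_subgroup [set: K] [set: K] (f x).
Proof.
(* The preimage of [[K, K]] is a subgroup containing the generating commutators. *)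
move=> C; apply: (C [set y | commutator_subgroup [set: K] [set: K] (f y)]).
split=> [|_ [a _ [b _ ->]]].
  split=> [|y z /set_mem yC /set_mem zC]; apply/mem_set; rewrite /= ?gmulf1.
    exact: commutator_subgroup1.
  by rewrite gmulfF; apply: commutator_subgroupM => //;
    apply: commutator_subgroupV.
by rewrite /= gmulfR; apply: mem_commutator_subgroup.
Qed.

Lemma lift_cochain_coboundary (G : groupType) (g : G) :
  coboundary (lift_cochain g) -> commutator_subgroup [set: G] [set: G] g.
Proof.
move=> /compatible_lift[c [cg cP]]; pose F := free (G * bool)%type.
have [p pE] := free_lift (fun x : G * bool => x.1).
have psurj y : exists x, p x = y by exists (free_gen (y, true)); rewrite pE.
pose E := kernel_ext (@free_is_free _) psurj.
have [q qE] := free_lift (fun x : G * bool => if x.2 then x.1 else 1).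
have copyP t : {i : {ghom F -> F} |
    forall x : G * bool, i (free_gen x) = free_gen (x.1, t)}.
  exact: free_lift.
have key t : commutator_subgroup [set: G] [set: G]
    (q (sval (copyP t) (c E)) / q (c E)).
  case: (copyP t) => i iE /=.
  (* Both copies of a generator lie over the same element of [G], so [i] is an endomorphism of
     [E]. *)
  have pi x : p (i x) = p x.
    by apply: (@free_hom_ext _ _ (p \o i) p) => y; rewrite /= iE !pE.
  have [f fE] := @free_ext_hom_of G E E i pi.
  by rewrite -gmulfF -fE; apply: ghom_commutator_subgroup (cP _ _ f).
(* The unknown [q (c E)] cancels in this product. *)
have := commutator_subgroupM (key true) (commutator_subgroupV (key false)).
case: (copyP true) (copyP false) => [i1 i1E] [i2 i2E] /=.
have -> : q (i1 (c E)) = g.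
  rewrite -(cg E).
  by apply: (@free_hom_ext _ _ (q \o i1) p) => y; rewrite /= i1E qE pE.
have -> : q (i2 (c E)) = 1.
  by apply: (@free_hom_ext _ _ (q \o i2) (@one_fun F G)) => y; rewrite /= i2E qE.
by rewrite div1g invgK mulgVK.
Qed.

Theorem theorem4p4 (G : groupType) (HG : ~ perfect G) :
  higher_lim_nontrivial (coinv_functor G) 1.
Proof.
apply: contrapT => triv; apply: HG; apply/seteqP; split=> // g _.
apply: lift_cochain_coboundary; apply: contrapT => NB.
exact/triv/(higher_lim_nontrivialP (lift_cocycle g)).
Qed.
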